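(* Let $n\ge1$ be an integer, let $p\in\mathbb{P}_{2n}^3$, let $\boldsymbol{\ell}_n(\theta)=(\cos(a_n\theta),\cos(b_n\theta),\cos(c_n\theta))$, $\theta\in[0,\pi]$, and let $$ \nu=n\max\{a_n,b_n,c_n\}=\begin{cases} \frac{3}{4}n^3+\frac{3}{2}n^2+n, & n\text{ even},\\[2pt] \frac{3}{4}n^3+\frac{3}{2}n^2+\frac{3}{4}n, & n\text{ odd}. \end{cases} $$ Then $$ \int_{[-1,1]^3}p(\boldsymbol{x})\,w(\boldsymbol{x})\,d\boldsymbol{x}=\sum_{s=0}^{\mu} w_s\,p(\boldsymbol{\ell}_n(\theta_s)),\qquad w_s=\pi^2\omega_s,\quad s=0,\dots,\mu, $$ for each of the following two choices of $\mu$, $\{\theta_s\}$, $\{\omega_s\}$: (i) $\mu=\nu$, $\ \theta_s=\dfrac{(2s+1)\pi}{2\mu+2}$, $\ \omega_s=\dfrac{\pi}{\mu+1}$, for $s=0,\dots,\mu$; (ii) $\mu=\nu+1$, $\ \theta_s=\dfrac{s\pi}{\mu}$ for $s=0,\dots,\mu$, $\ \omega_0=\omega_\mu=\dfrac{\pi}{2\mu}$, and $\omega_s=\dfrac{\pi}{\mu}$ for $s=1,\dots,\mu-1$.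
   Context: $\mathbb{P}_k^3$ denotes the space of trivariate polynomials of total degree not exceeding $k$. The product Chebyshev weight on $[-1,1]^3$ is $$w(\boldsymbol{x})=\frac{1}{\sqrt{(1-x_1^2)(1-x_2^2)(1-x_3^2)}}.$$ For each integer $n\ge1$, the integer triple $(a_n,b_n,c_n)$ is $$ (a_n,b_n,c_n)=\begin{cases} \left(\frac{3}{4}n^2+\frac{1}{2}n,\ \frac{3}{4}n^2+n,\ \frac{3}{4}n^2+\frac{3}{2}n+1\right), & n \text{ even},\\[4pt] \left(\frac{3}{4}n^2+\frac{1}{4},\ \frac{3}{4}n^2+\frac{3}{2}n-\frac{1}{4},\ \frac{3}{4}n^2+\frac{3}{2}n+\frac{3}{4}\right), & n \text{ odd}. \end{cases} $$ *)

(* Defs.v *)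
From mathcomp Require Import all_boot all_order all_algebra.
From mathcomp Require Import ring lra zify.
From mathcomp Require Import all_classical all_reals all_analysis.
(* The notations of mpoly clash with those of all_analysis. *)
From mathcomp Require Import -(notations) mpoly.

Set Implicit Arguments.
Unset Strict Implicit.
Unset Printing Implicit Defensive.
Import Order.TTheory GRing.Theory Num.Theory.
Import numFieldNormedType.Exports.
Local Open Scope classical_set_scope.
Local Open Scope ring_scope.

(* The three frequencies of the curve. The divisions by 4 are exact for n >= 1,
   and so is the subtraction in [freq_b]: see [freq_aE], [freq_bE], [freq_cE]. *)
Definition freq_a (n : nat) : nat :=
  ((if odd n then 3 * n ^ 2 + 1 else 3 * n ^ 2 + 2 * n) %/ 4)%N.

Definition freq_b (n : nat) : nat :=
  ((if odd n then 3 * n ^ 2 + 6 * n - 1 else 3 * n ^ 2 + 4 * n) %/ 4)%N.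

Definition freq_c (n : nat) : nat :=
  ((if odd n then 3 * n ^ 2 + 6 * n + 3 else 3 * n ^ 2 + 6 * n + 4) %/ 4)%N.

Definition nu (n : nat) : nat :=
  (n * maxn (maxn (freq_a n) (freq_b n)) (freq_c n))%N.

Lemma freq_aE (F : numFieldType) (n : nat) : (1 <= n)%N ->
  (freq_a n)%:R = (if odd n then 3 / 4 * n%:R ^+ 2 + 1 / 4
                   else 3 / 4 * n%:R ^+ 2 + 1 / 2 * n%:R) :> F.
Proof.
move=> _; rewrite /freq_a; have := odd_double_half n.
case: (odd n) => /=; move: n./2 => m <-.
  rewrite (_ : (_ + 1)%N = ((3 * m ^ 2 + 3 * m + 1) * 4)%N); last by lia.
  by rewrite mulnK // -mul2n !(natrD, natrM, natrX); field.
rewrite add0n (_ : (_ + _)%N = ((3 * m ^ 2 + m) * 4)%N); last by lia.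
by rewrite mulnK // -mul2n !(natrD, natrM, natrX); field.
Qed.

Lemma freq_bE (F : numFieldType) (n : nat) : (1 <= n)%N ->
  (freq_b n)%:R = (if odd n then 3 / 4 * n%:R ^+ 2 + 3 / 2 * n%:R - 1 / 4
                   else 3 / 4 * n%:R ^+ 2 + n%:R) :> F.
Proof.
move=> _; rewrite /freq_b; have := odd_double_half n.
case: (odd n) => /=; move: n./2 => m <-.
  rewrite (_ : (_ - 1)%N = ((3 * m ^ 2 + 6 * m + 2) * 4)%N); last by lia.
  by rewrite mulnK // -mul2n !(natrD, natrM, natrX); field.
rewrite add0n (_ : (_ + _)%N = ((3 * m ^ 2 + 2 * m) * 4)%N); last by lia.
by rewrite mulnK // -mul2n !(natrD, natrM, natrX); field.
Qed.

Lemma freq_cE (F : numFieldType) (n : nat) : (1 <= n)%N ->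
  (freq_c n)%:R = (if odd n then 3 / 4 * n%:R ^+ 2 + 3 / 2 * n%:R + 3 / 4
                   else 3 / 4 * n%:R ^+ 2 + 3 / 2 * n%:R + 1) :> F.
Proof.
move=> _; rewrite /freq_c; have := odd_double_half n.
case: (odd n) => /=; move: n./2 => m <-.
  rewrite (_ : (_ + 3)%N = ((3 * m ^ 2 + 6 * m + 3) * 4)%N); last by lia.
  by rewrite mulnK // -mul2n !(natrD, natrM, natrX); field.
rewrite add0n (_ : (_ + 4)%N = ((3 * m ^ 2 + 3 * m + 1) * 4)%N); last by lia.
by rewrite mulnK // -mul2n !(natrD, natrM, natrX); field.
Qed.

(* Trivariate polynomials of total degree at most k; msize is degree + 1,
   and msize 0 = 0. *)
Definition poly3_le (R : realType) (k : nat) : set (mpoly 3 R) :=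
  [set p | (msize p <= k.+1)%N].

Definition eval3 (R : realType) (p : mpoly 3 R) (x : R * R * R) : R :=
  meval (tnth [tuple x.1.1; x.1.2; x.2]) p.

Definition cube (R : realType) : set (R * R * R) :=
  `[-1, 1] `*` `[-1, 1] `*` `[-1, 1].
Arguments cube : clear implicits.

(* On the faces of the cube, a null set, the inverse takes the value 0^-1 = 0. *)
Definition cheb_weight (R : realType) (x : R * R * R) : R :=
  1 / Num.sqrt ((1 - x.1.1 ^+ 2) * (1 - x.1.2 ^+ 2) * (1 - x.2 ^+ 2)).

Definition lebesgue3 (R : realType) :
    {measure set (measurableTypeR R * measurableTypeR R * measurableTypeR R)
     -> \bar R} :=
  ((@lebesgue_measure R \x @lebesgue_measure R) \x @lebesgue_measure R)%E.

Definition curve (R : realType) (n : nat) (theta : R) : R * R * R :=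
  (cos ((freq_a n)%:R * theta), cos ((freq_b n)%:R * theta),
   cos ((freq_c n)%:R * theta)).

(* Main.v *)
Require Import Defs.
From HB Require Import structures.
From mathcomp Require Import all_boot all_order all_algebra.
From mathcomp Require Import ring lra zify.
From mathcomp Require Import all_classical all_reals all_analysis.
From mathcomp Require Import measurable_realfun.
From mathcomp Require Import -(notations) mpoly.
Import Order.TTheory GRing.Theory Num.Theory.
Import numFieldNormedType.Exports.
Local Open Scope classical_set_scope.
Local Open Scope ring_scope.

(* The frequencies are independent up to order 2n: no nonzero integer triple
   (x, y, z) with |x| + |y| + |z| <= 2n satisfies a_n x + b_n y + c_n z = 0.
   Expand each factor of a monomial x1^i x2^j x3^k, i + j + k <= 2n, in the
   cosines cos(k t), x = cos t. On the curve this produces products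
   cos(i' a t) cos(j' b t) cos(k' c t), that is, averages of
   cos((i' a +- j' b +- k' c) t); by independence only i' = j' = k' = 0 yields
   the zero frequency, so the mean over the curve is the product of the three
   Chebyshev means. All the frequencies are at most 2 n c_n = 2 nu < 2 mu + 2,
   resp. 2 nu < 2 mu, and the midpoint, resp. trapezoidal, rule with these nodes
   integrates such cosines exactly. *)

(** * Independence of the frequencies *)

(** Here and in [freq_odd], passing to the half of [n] removes the division by 4, so a relation
    between the frequencies becomes polynomial in [m]. *)
Lemma freq_even (m : nat) : let n := m.*2 in
  [/\ freq_a n = (3 * m ^ 2 + m)%N, freq_b n = (3 * m ^ 2 + 2 * m)%N &
      freq_c n = (3 * m ^ 2 + 3 * m + 1)%N].
Proof.
rewrite /freq_a /freq_b /freq_c odd_double -mul2n; split.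
- by rewrite (_ : (_ + _)%N = ((3 * m ^ 2 + m) * 4)%N) ?mulnK; lia.
- by rewrite (_ : (_ + _)%N = ((3 * m ^ 2 + 2 * m) * 4)%N) ?mulnK; lia.
- by rewrite (_ : (_ + 4)%N = ((3 * m ^ 2 + 3 * m + 1) * 4)%N) ?mulnK; lia.
Qed.

Lemma freq_odd (m : nat) : let n := m.*2.+1 in
  [/\ freq_a n = (3 * m ^ 2 + 3 * m + 1)%N,
      freq_b n = (3 * m ^ 2 + 6 * m + 2)%N &
      freq_c n = (3 * m ^ 2 + 6 * m + 3)%N].
Proof.
rewrite /freq_a /freq_b /freq_c /= odd_double /= -mul2n; split.
- by rewrite (_ : (_ + _)%N = ((3 * m ^ 2 + 3 * m + 1) * 4)%N) ?mulnK; lia.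
- by rewrite (_ : (_ - _)%N = ((3 * m ^ 2 + 6 * m + 2) * 4)%N) ?mulnK; lia.
- by rewrite (_ : (_ + 3)%N = ((3 * m ^ 2 + 6 * m + 3) * 4)%N) ?mulnK; lia.
Qed.

Lemma freq_leq (n : nat) : (1 <= n)%N ->
  (freq_a n <= freq_c n)%N /\ (freq_b n <= freq_c n)%N.
Proof.
move=> n1; have := odd_double_half n; case: (odd n) => /= <-.
  by have [-> -> ->] := freq_odd n./2; lia.
by rewrite add0n; have [-> -> ->] := freq_even n./2; lia.
Qed.

Lemma nuE (n : nat) : (1 <= n)%N -> nu n = (n * freq_c n)%N.
Proof. by move=> /freq_leq[ac bc]; rewrite /nu (maxn_idPr _)// geq_max ac bc. Qed.

(* Modulo m the relation reads z = 0, so z = m t, and x, y, z become linear forms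
   in S = x + y + z and t; the size bound leaves finitely many pairs (S, t). *)
Lemma freq_independent_even (m x y z : int) :
  1 <= m -> `|x| + `|y| + `|z| <= 4 * m ->
  (3 * m ^+ 2 + m) * x + (3 * m ^+ 2 + 2 * m) * y
    + (3 * m ^+ 2 + 3 * m + 1) * z = 0 ->
  [/\ x = 0, y = 0 & z = 0].
Proof.
move=> m1 le eq0.
set S := x + y + z.
set t := - ((3 * m + 1) * S + y + 2 * z).
have zE : z = m * t.
  by apply/eqP; rewrite -subr_eq0 -[X in _ == X]eq0 /t /S; apply/eqP; ring.
have yE : y = - (3 * m + 1) * S - (2 * m + 1) * t.
  rewrite (_ : (2 * m + 1) * t = 2 * (m * t) + t); last by ring.
  by rewrite -zE /t /S; ring.
have xE : x = (3 * m + 2) * S + (m + 1) * t.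
  by rewrite (_ : x = S - y - z) ?[in LHS]yE ?[in LHS]zE /S; ring.
clearbody S t; clear eq0.
have t4 : -4 <= t <= 4.
  have : `|m * t| <= m * 4 by rewrite -zE; lia.
  by rewrite normrM (ger0_norm (_ : 0 <= m)) ?ler_pM2l; lia.
(* Eliminating [t] gives 3 (2m + 1) S = x - y - 3z - 2t, of size at most 12m + 8; hence 3 |S| <=
   8. *)
have S2 : -2 <= S <= 2.
  have : `|(2 * m + 1) * (3 * S)| <= (2 * m + 1) * 8.
    rewrite (_ : _ * _ = x - y - 3 * z - 2 * t); last by rewrite xE yE zE; ring.
    by lia.
  by rewrite normrM (ger0_norm (_ : 0 <= 2 * m + 1)) ?ler_pM2l; lia.
have : S \in [:: -2; -1; 0; 1; 2] by rewrite !inE; lia.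
have : t \in [:: -4; -3; -2; -1; 0; 1; 2; 3; 4] by rewrite !inE; lia.
rewrite !inE => tE SE.
suff [t0 S0] : t = 0 /\ S = 0 by rewrite xE yE zE t0 S0 !mulr0; split.
(* For each fixed pair, [x], [y], [z] are affine in [m], and [le] contradicts [m1] unless the pair
   is (0, 0). *)
by move: tE SE; do 8?[case/orP]; move=> /eqP tE; do 4?[case/orP];
  move=> /eqP SE; rewrite tE SE in xE yE zE *; lia.
Qed.

(* Here the relation reads y - x = 3 (m + 1) r with r = (m + 1) S - x. *)
Lemma freq_independent_odd (m x y z : int) :
  0 <= m -> `|x| + `|y| + `|z| <= 4 * m + 2 ->
  (3 * m ^+ 2 + 3 * m + 1) * x + (3 * m ^+ 2 + 6 * m + 2) * y
    + (3 * m ^+ 2 + 6 * m + 3) * z = 0 ->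
  [/\ x = 0, y = 0 & z = 0].
Proof.
move=> m0 le eq0.
set S := x + y + z.
set r := (m + 1) * S - x.
have xE : x = (m + 1) * S - r by rewrite /r; ring.
(* The frequencies fall short of 3 (m + 1)^2 by 3m + 2, 1 and 0, so the relation says y = 3 (m +
   1)^2 S - (3m + 2) x. *)
have yE : y = (m + 1) * S + (3 * m + 2) * r.
  by apply/eqP; rewrite -subr_eq0 -[X in _ == X]oppr0 -[X in _ == - X]eq0 /r /S;
    apply/eqP; ring.
have zE : z = - (2 * m + 1) * S - (3 * m + 1) * r.
  by rewrite (_ : z = S - x - y) ?[in LHS]yE ?[in LHS]xE /S; ring.
clearbody S r; clear eq0.
have r1 : -1 <= r <= 1.
  have : `|(3 * m + 3) * r| < (3 * m + 3) * 2.
    by rewrite (_ : _ * _ = y - x); [lia|rewrite xE yE; ring].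
  by rewrite normrM (ger0_norm (_ : 0 <= 3 * m + 3)) ?ltr_pM2l; lia.
(* (m + 1) S = x + r has size at most (4m + 2) + 1, just below 4 (m + 1). *)
have S3 : -3 <= S <= 3.
  have : `|(m + 1) * S| < (m + 1) * 4.
    by rewrite (_ : _ * _ = x + r); [lia|rewrite xE; ring].
  by rewrite normrM (ger0_norm (_ : 0 <= m + 1)) ?ltr_pM2l; lia.
have : S \in [:: -3; -2; -1; 0; 1; 2; 3] by rewrite !inE; lia.
have : r \in [:: -1; 0; 1] by rewrite !inE; lia.
rewrite !inE => rE SE.
suff [r0 S0] : r = 0 /\ S = 0 by rewrite xE yE zE r0 S0 !mulr0; split.
by move: rE SE; do 2?[case/orP]; move=> /eqP rE; do 6?[case/orP];
  move=> /eqP SE; rewrite rE SE in xE yE zE *; lia.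
Qed.

Lemma freq_independent (n : nat) (x y z : int) : (1 <= n)%N ->
  `|x| + `|y| + `|z| <= (2 * n)%:Z ->
  (freq_a n)%:Z * x + (freq_b n)%:Z * y + (freq_c n)%:Z * z = 0 ->
  [/\ x = 0, y = 0 & z = 0].
Proof.
move=> n1; have := odd_double_half n; case: (odd n) => /= nE.
  rewrite -nE add1n; have [-> -> ->] := freq_odd n./2 => le eq0.
  apply: (@freq_independent_odd n./2%:Z); [lia|lia|].
  by rewrite -eq0; move: n./2 => m; lia.
rewrite -nE add0n; have [-> -> ->] := freq_even n./2 => le eq0.
apply: (@freq_independent_even n./2%:Z); [lia|lia|].
by rewrite -eq0; move: n./2 => m; lia.
Qed.

(** * Quadrature of cosines *)

Lemma sin_natmul_pi {R : realType} (n : nat) : sin (n%:R * pi) = 0 :> R.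
Proof.
by elim: n => [|n IHn]; rewrite ?mul0r ?sin0// -natr1 mulrDl mul1r sinDpi IHn oppr0.
Qed.

Lemma cosB_add_cosD {R : realType} (u v : R) :
  cos (u - v) + cos (u + v) = cos u * (2 * cos v).
Proof. by rewrite cosB cosD; ring. Qed.

Lemma cos_intE {R : realType} (m : int) (x : R) :
  cos (m%:~R * x) = cos (`|m|%N%:R * x).
Proof. by case: m => n //; rewrite NegzE mulrNz mulNr cosN. Qed.

(** With phi = m pi / (2N), multiplying by sin phi makes the sum telescope to sin(m pi) / 2 = 0. The
    range of [m] puts phi strictly between 0 and pi, so sin phi is nonzero. *)
Lemma sum_cos_midpoints {R : realType} (N m : nat) : (0 < m < 2 * N)%N ->
  \sum_(0 <= s < N) cos (m%:R * ((2 * s + 1)%:R * pi / (2 * N)%:R)) = 0 :> R.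
Proof.
move=> /andP[m0 mN].
have N0 : (2 * N)%:R != 0 :> R by rewrite pnatr_eq0; lia.
pose phi : R := m%:R * pi / (2 * N)%:R.
have sphi : sin phi != 0.
  rewrite gt_eqF// sin_gt0_pi// divr_gt0 ?mulr_gt0 ?ltr0n ?pi_gt0//=; last by lia.
  by rewrite ltr_pdivrMr ?ltr0n ?(mulrC pi) ?ltr_pM2r ?pi_gt0 ?ltr_nat//; lia.
apply: (mulfI sphi); rewrite mulr0 mulr_sumr.
under eq_bigr => s _.
  rewrite (_ : sin phi * _ = (sin (phi * (2 * s.+1)%:R) - sin (phi * (2 * s)%:R)) / 2).
    over.
  rewrite (_ : phi * (2 * s.+1)%:R = phi * (2 * s + 1)%:R + phi); last first.
    by rewrite -addn1 !natrD !natrM; ring.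
  rewrite (_ : phi * (2 * s)%:R = phi * (2 * s + 1)%:R - phi); last first.
    by rewrite natrD natrM; ring.
  rewrite sinD sinB (_ : m%:R * _ = phi * (2 * s + 1)%:R); last first.
    by rewrite /phi; ring.
  by field.
rewrite -mulr_suml telescope_sumr//= muln0 mulr0 sin0 subr0 /phi.
by rewrite divfK// sin_natmul_pi mul0r.
Qed.

(** Exactness, up to degree [d], for the integral of cosines over [0, pi]. Both rules enter the main
    argument only through this property. Frequencies are signed because product formulas produce
    differences. *)
Definition is_cos_quadrature {R : realType} (d N : nat) (omega theta : nat -> R) :=
  forall m : int, (`|m| <= d)%N ->
    \sum_(0 <= s < N) omega s * cos (m%:~R * theta s) = if m == 0 then pi else 0.

Lemma midpoint_quadrature {R : realType} (d mu : nat) : (d < 2 * mu + 2)%N ->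
  is_cos_quadrature d mu.+1 (fun s => pi / (mu + 1)%:R)
    (fun s => (2 * s + 1)%:R * pi / (2 * mu + 2)%:R : R).
Proof.
move=> dmu m md; rewrite -mulr_sumr; case: eqVneq => [->|m0].
  under eq_bigr do rewrite mul0r cos0.
  rewrite sumr_const_nat subn0 -[X in _ * X]/(mu.+1%:R) addn1.
  by rewrite divfK ?pnatr_eq0.
rewrite (_ : (2 * mu + 2)%N = (2 * mu.+1)%N); last by lia.
under eq_bigr do rewrite cos_intE.
by rewrite sum_cos_midpoints ?mulr0//; lia.
Qed.

(** The halved end weights make the rule a sum, over [mu] subintervals, of averages of the two end
    values. Each pair of end values is the cosine at the midpoint times a factor independent of the
    subinterval, which leaves the midpoint sum with [mu] nodes. *)
Lemma trapezoid_quadrature {R : realType} (d mu : nat) : (d < 2 * mu)%N ->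
  is_cos_quadrature d mu.+1
    (fun s => if (s == 0%N) || (s == mu) then pi / (2 * mu)%:R else pi / mu%:R)
    (fun s => s%:R * pi / mu%:R : R).
Proof.
move=> dmu m md.
have mu0 : mu%:R != 0 :> R by rewrite pnatr_eq0; lia.
have mu20 : (2 * mu)%:R != 0 :> R by rewrite pnatr_eq0; lia.
set f := fun s : nat => cos (m%:~R * (s%:R * pi / mu%:R)) : R.
have -> : \sum_(0 <= s < mu.+1)
    (if (s == 0%N) || (s == mu) then pi / (2 * mu)%:R else pi / mu%:R) * f s =
    \sum_(0 <= s < mu) pi / (2 * mu)%:R * (f s + f s.+1).
  rewrite -mulr_sumr big_split/=.
  case: (mu) dmu mu20 => [|k] dk k0; first by lia.
  rewrite big_nat_recr//= big_nat_recl//= eqxx /=.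
  rewrite (big_nat_recr k _ (fun i => f i.+1))//= (big_nat_recl k)//=.
  rewrite (eq_big_nat _ _ (F2 := fun i => pi / k.+1%:R * f i.+1)); last first.
    by move=> i ik; rewrite eqSS ltn_eqF//; lia.
  rewrite -mulr_sumr natrM; set X := \sum_(_ <= _ < _) _.
  by field; rewrite nat1r pnatr_eq0.
rewrite -mulr_sumr /f; case: eqVneq => [->|m0].
  under eq_bigr do rewrite !mul0r cos0.
  rewrite sumr_const_nat subn0 -mulr_natr natrM; field.
  exact: mu0.
under eq_bigr => s _.
  rewrite !cos_intE.
  set a := `|m|%N%:R : R.
  rewrite (_ : a * (s%:R * pi / mu%:R) =
    a * ((2 * s + 1)%:R * pi / (2 * mu)%:R) - a * (pi / (2 * mu)%:R)); last first.
    by rewrite !(natrD, natrM); field.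
  rewrite (_ : a * (s.+1%:R * pi / mu%:R) =
    a * ((2 * s + 1)%:R * pi / (2 * mu)%:R) + a * (pi / (2 * mu)%:R)); last first.
    by rewrite -addn1 !(natrD, natrM); field.
  rewrite cosB_add_cosD.
  over.
by rewrite -mulr_suml sum_cos_midpoints ?mul0r ?mulr0//; lia.
Qed.

(** The product of the three cosines is the average of the cosines of the four signed sums of their
    arguments, all of frequency at most [d]. *)
Lemma cos_product_quadrature {R : realType} (d N : nat) (omega theta : nat -> R)
    (i j k : nat) : is_cos_quadrature d N omega theta ->
  (i + j + k <= d)%N ->
  \sum_(0 <= s < N) omega s *
    (cos (i%:R * theta s) * cos (j%:R * theta s) * cos (k%:R * theta s)) =
  pi / 4 * ((i%:Z + j%:Z + k%:Z == 0)%:R + (i%:Z + j%:Z - k%:Z == 0)%:R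
          + (i%:Z - j%:Z + k%:Z == 0)%:R + (i%:Z - j%:Z - k%:Z == 0)%:R).
Proof.
move=> quad ijk.
under eq_bigr => s _.
  rewrite (_ : _ * _ = 4^-1 * (omega s * cos ((i%:Z + j%:Z + k%:Z)%:~R * theta s)
    + omega s * cos ((i%:Z + j%:Z - k%:Z)%:~R * theta s)
    + omega s * cos ((i%:Z - j%:Z + k%:Z)%:~R * theta s)
    + omega s * cos ((i%:Z - j%:Z - k%:Z)%:~R * theta s))).
    over.
  rewrite !(rmorphD, rmorphN)/= !mulrDl !mulNr.
  rewrite !(cosD, sinD, cosN, sinN).
  by rewrite -!pmulrn; field.
rewrite -mulr_sumr !big_split/= !quad; try lia.
have E (b : bool) : (if b then pi else 0) = pi * b%:R :> R.
  by case: b; rewrite ?mulr1 ?mulr0.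
by rewrite !E; ring.
Qed.

(** Induction on [i] with cos x cos(kx) = (cos((k+1)x) + cos((k-1)x)) / 2. Existence suffices: the
    integral and the quadrature sum both reduce to the constant terms, whatever their values. *)
Lemma cosXn_fourier {R : realType} (i : nat) : exists t : nat -> R,
  forall x, cos x ^+ i = \sum_(k < i.+1) t k * cos (k%:R * x).
Proof.
elim: i => [|i [t tE]].
  by exists (fun=> 1) => x; rewrite big_ord1 mul0r cos0 mulr1.
(* Cutting [t] off after [i] makes the extra terms of the shifted sums vanish. *)
pose s k := (if (k <= i)%N then t k else 0).
have s0 k : (i < k)%N -> s k = 0 by rewrite /s ltnNge => /negbTE ->.
(* The correction at index 1 is the downward shift of the constant term: cos(0 x - x) = cos x. *)
exists (fun k => (if k is l.+1 then s l else 0) / 2 + s k.+1 / 2 +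
  (if k == 1%N then s 0%N / 2 else 0)) => x.
have sE : cos x ^+ i = \sum_(k < i.+1) s k * cos (k%:R * x).
  by rewrite tE; apply: eq_bigr => k _; rewrite /s -ltnS ltn_ord.
have -> : cos x ^+ i.+1 = \sum_(k < i.+1) s k / 2 * cos (k.+1%:R * x) +
    \sum_(k < i.+1) s k / 2 * cos (k%:R * x - x).
  rewrite exprSr sE mulr_suml -big_split/=; apply: eq_bigr => k _.
  by rewrite -[k.+1%:R]natr1 mulrDl mul1r cosD cosB; field.
under [RHS]eq_bigr do rewrite 2!mulrDl.
rewrite !big_split/=; rewrite -addrA; congr (_ + _).
  by rewrite [RHS]big_ord_recl /= !mul0r add0r.
rewrite [LHS]big_ord_recl mul0r sub0r cosN [RHS]addrC; congr (_ + _).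
  rewrite [RHS]big_ord_recl mul0r add0r [RHS]big_ord_recl/= mul1r big1 ?addr0//.
  by move=> k _; rewrite mul0r.
rewrite [RHS]big_ord_recr/= (s0 i.+2)// !mul0r addr0.
rewrite [RHS]big_ord_recr/= (s0 i.+1)// !mul0r addr0.
by apply: eq_bigr => k _; rewrite /= -[k.+1%:R]natr1 mulrDl mul1r addrK.
Qed.

(** By [freq_independent], none of the four signed frequencies vanishes unless [i], [j], [k] are all
    0. Each is at most c_n (i + j + k), hence at most 2 n c_n = 2 nu. *)
Lemma freq_cos_quadrature {R : realType} (n N : nat) (omega theta : nat -> R)
    (i j k : nat) : (1 <= n)%N -> is_cos_quadrature (2 * nu n) N omega theta ->
  (i + j + k <= 2 * n)%N ->
  \sum_(0 <= s < N) omega s *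
    (cos (i%:R * ((freq_a n)%:R * theta s)) *
     cos (j%:R * ((freq_b n)%:R * theta s)) *
     cos (k%:R * ((freq_c n)%:R * theta s))) =
  if (i == 0%N) && (j == 0%N) && (k == 0%N) then pi else 0.
Proof.
move=> n1 quad ijk; have [ac bc] := freq_leq _ n1.
under eq_bigr => s _.
  rewrite (_ : _ * _ = omega s * (cos ((freq_a n * i)%:R * theta s) *
    cos ((freq_b n * j)%:R * theta s) * cos ((freq_c n * k)%:R * theta s))).
    over.
  by rewrite !mulrA -!natrM [(i * _)%N]mulnC [(j * _)%N]mulnC [(k * _)%N]mulnC.
rewrite (cos_product_quadrature _ _ _ _ _ _ _ quad); last first.
  rewrite nuE//; apply: (@leq_trans (freq_c n * (i + j + k))%N).
    rewrite !mulnDr; apply: leq_add; first apply: leq_add;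
      by rewrite leq_mul2r ?ac ?bc ?leqnn orbT.
  by rewrite mulnA [leqLHS]mulnC leq_mul2r ijk orbT.
(* The signs [e1], [e2] cover all four combinations at once. *)
have E (e1 e2 : int) : `|e1| = 1 -> `|e2| = 1 ->
    ((freq_a n * i)%N%:Z + e1 * (freq_b n * j)%N%:Z + e2 * (freq_c n * k)%N%:Z == 0)
    = (i == 0%N) && (j == 0%N) && (k == 0%N).
  move=> e11 e21; apply/eqP/andP => [eq0|[/andP[/eqP-> /eqP->] /eqP->]]; last first.
    by rewrite !muln0 !mulr0.
  have [||] := @freq_independent n i%:Z (e1 * j%:Z) (e2 * k%:Z) n1.
  - by rewrite !normrM e11 e21 !mul1r; lia.
  - by rewrite -[RHS]eq0 !PoszM; ring.
  - move=> i0 /eqP + /eqP; rewrite !mulf_eq0 => j0 k0; lia.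
have := E 1 1; have := E 1 (-1); have := E (-1) 1; have := E (-1) (-1).
rewrite !mul1r !mulN1r => -> // -> // -> // -> //.
by case: ifP => _; rewrite ?mulr1n ?mulr0n; field.
Qed.

(** * Moments of the Chebyshev weight *)

Lemma derive1_cosE {R : realType} : (@cos R)^`()%classic = (fun x => - sin x).
Proof. by apply/funext => x; rewrite derive1E derive_val. Qed.

Lemma sqrt_1Bcos2 {R : realType} (x : R) : 0 < x < pi ->
  Num.sqrt (1 - cos x ^+ 2) = sin x.
Proof. by move=> x0pi; rewrite -sin2cos2 sqrtr_sqr ger0_norm ?ltW ?sin_gt0_pi. Qed.

Lemma continuous_div_arcsine {R : realType} (g : R -> R) : continuous g ->
  {in `]-1, 1[, continuous (fun x : R => g x / Num.sqrt (1 - x ^+ 2))}.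
Proof.
move=> cg x; rewrite in_itv/= => x1.
apply: cvgM; first exact: cg.
apply: cvgV; first by rewrite gt_eqF// sqrtr_gt0; nra.
apply: (@continuous_comp _ _ _ (fun x : R => 1 - x ^+ 2) Num.sqrt).
  by apply: cvgB; [exact: cvg_cst|exact: exprn_continuous].
exact: sqrt_continuous.
Qed.

(** Continuity holds on the open interval, and adding the two endpoints preserves measurability. *)
Lemma measurable_div_arcsine {R : realType} (g : R -> R) (D : set R) :
  continuous g -> measurable D -> D `<=` `[-1, 1] ->
  measurable_fun D (fun x : R => g x / Num.sqrt (1 - x ^+ 2)).
Proof.
move=> cg mD D1; apply: (measurable_funS (measurable_itv _) D1).
apply: (@measurable_fun_itv_cc _ _ _ false true).
apply: open_continuous_measurable_fun; first exact: interval_open.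
by move=> x; rewrite inE; exact: continuous_div_arcsine.
Qed.

(** Substitution x = cos t. The weight is singular at both ends, so the substitution is made on
    compact subintervals; monotone convergence, for which [g] is taken nonnegative, then gives the
    limit. *)
Lemma ge0_integral_arcsine {R : realType} (g : R -> R) : continuous g ->
  (forall x, -1 <= x <= 1 -> 0 <= g x) ->
  (\int[lebesgue_measure]_(x in `[(-1)%R, 1%R]) (g x / Num.sqrt (1 - x ^+ 2))%:E =
   \int[lebesgue_measure]_(x in `[0%R, pi]) (g (cos x))%:E)%E.
Proof.
move=> cg g0.
set h := fun x : R => g x / Num.sqrt (1 - x ^+ 2).
pose e n : R := n.+1%:R^-1.
have e0 n : 0 < e n by rewrite invr_gt0.
have e1 n : e n <= 1 by rewrite invf_le1// ler1n.
have pi2 := pi_ge2 R.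
have edec m n : (m <= n)%N -> e n <= e m.
  by move=> mn; rewrite lef_pV2// ?posrE// ler_nat.
have esmall (x : R) : 0 < x -> exists n, e n < x.
  move=> x0; have [n _ /(_ _ (leqnn n))] := near_infty_natSinv_lt (PosNum x0).
  by exists n.
have in0pi x n : e n <= x <= pi - e n -> 0 < x < pi.
  by move=> /andP[ex xe]; have := e0 n; lra.
have lecos (x y : R) : 0 <= x -> x <= y -> y <= pi -> cos y <= cos x.
  move=> x0; rewrite le_eqVlt => /orP[/eqP->//|xy] ypi.
  by rewrite ltW// ltr_cos ?in_itv/=; lra.
have cosA1 n : -1 < cos (pi - e n) /\ cos (e n) < 1.
  split; first rewrite -(@cospi R); last rewrite -cos0;
    by rewrite ltr_cos ?in_itv/=; have := e0 n; have := e1 n; lra.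
pose A n : set R := `[cos (pi - e n), cos (e n)]%classic.
pose B n : set R := `[e n, pi - e n]%classic.
have AB n : (\int[lebesgue_measure]_(x in A n) (h x)%:E =
             \int[lebesgue_measure]_(x in B n) (g (cos x))%:E)%E.
  have ene : e n <= pi - e n by have := e1 n; lra.
  rewrite /A integration_by_substitution_decreasing//.
  (* The Jacobian sin t cancels the square root, as sin t > 0 on [B n]. *)
  - apply: eq_integral => x; rewrite inE/= in_itv/= => /in0pi x0pi.
    rewrite fctE /h/= derive1_cosE opprK sqrt_1Bcos2// divfK//.
    by rewrite gt_eqF// sin_gt0_pi.
  - move=> x y; rewrite !in_itv/= => /in0pi /andP[x0 xpi] /in0pi /andP[y0 ypi] yx.
    by rewrite ltr_cos ?in_itv/= ?ltW.
  - by rewrite derive1_cosE => x _; apply: continuousN; exact: continuous_sin.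
  - rewrite derive1_cosE; apply/cvg_ex; exists (- sin (e n)).
    by apply: cvg_at_right_filter; apply: continuousN; exact: continuous_sin.
  - rewrite derive1_cosE; apply/cvg_ex; exists (- sin (pi - e n)).
    by apply: cvg_at_left_filter; apply: continuousN; exact: continuous_sin.
  - split; first by move=> x _; exact: derivable_cos.
    + by apply: cvg_at_right_filter; exact: continuous_cos.
    + by apply: cvg_at_left_filter; exact: continuous_cos.
  - apply: continuous_in_subspaceT => x; rewrite inE/= in_itv/= => /andP[x1 x2].
    apply: continuous_div_arcsine => //; rewrite in_itv/=.
    by have [c1 c2] := cosA1 n; rewrite (lt_le_trans c1 x1) (le_lt_trans x2 c2).
have cgcos : continuous (fun x : R => g (cos x)).
  by move=> x; apply: continuous_comp; [exact: continuous_cos|exact: cg].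
have Asub n : A n `<=` `[-1, 1].
  move=> x /andP[]; rewrite !bnd_simp => x1 x2; rewrite /= in_itv/=.
  by rewrite (le_trans (cos_geN1 _) x1) (le_trans x2 (cos_le1 _)).
have h0 x : -1 <= x <= 1 -> 0 <= h x.
  by move=> x1; rewrite divr_ge0 ?sqrtr_ge0 ?g0.
have cvgA : (\int[lebesgue_measure]_(x in A n) (h x)%:E)%E @[n --> \oo] -->
    (\int[lebesgue_measure]_(x in `](-1)%R, 1%R[) (h x)%:E)%E.
  have -> : `]-1, 1[%classic = \bigcup_n A n.
    apply/seteqP; split=> [x /=|x [n _ /andP[]]].
      rewrite in_itv/= => /andP[x1 x2].
      have a0 : 0 < acos x by rewrite acos_gt0// (ltW x1).
      have api : acos x < pi by rewrite acos_ltpi// x1 (ltW x2).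
      have xE : cos (acos x) = x by rewrite acosK// in_itv/= !ltW.
      (* [x] lies in [A n] as soon as acos x is at distance at least [e n] from both 0 and pi. *)
      have [|n] := esmall (Num.min (acos x) (pi - acos x)).
        by rewrite lt_min a0 subr_gt0.
      rewrite lt_min => /andP[n1 n2]; exists n => //.
      rewrite /A/= in_itv/= -xE; have := e0 n => en.
      by rewrite !lecos//; lra.
    rewrite !bnd_simp => x1 x2; rewrite /= in_itv/=.
    by have [c1 c2] := cosA1 n; rewrite (lt_le_trans c1 x1) (le_lt_trans x2 c2).
  apply: ge0_nondecreasing_set_cvg_integral.
  - move=> m n mn; rewrite subsetEset; apply: subset_itv; rewrite bnd_simp lecos//;
      by have := edec _ _ mn; have := e0 n; have := e1 m; lra.
  - by move=> n; exact: measurable_itv.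
  - move=> n; apply/measurable_EFinP; apply: measurable_div_arcsine.
    + exact: cg.
    + exact: measurable_itv.
    + exact: Asub.
  - by move=> n x /Asub /=; rewrite in_itv/= lee_fin => /h0.
have cvgB : (\int[lebesgue_measure]_(x in B n) (g (cos x))%:E)%E @[n --> \oo] -->
    (\int[lebesgue_measure]_(x in `]0%R, pi[) (g (cos x))%:E)%E.
  have -> : `]0, pi[%classic = \bigcup_n B n.
    apply/seteqP; split=> [x /=|x [n _]]; last first.
      by rewrite /B/= !in_itv/=; exact: in0pi.
    rewrite in_itv/= => /andP[x0 xpi].
    have [|n] := esmall (Num.min x (pi - x)); first by rewrite lt_min x0 subr_gt0.
    by rewrite lt_min => /andP[n1 n2]; exists n => //; rewrite /B/= in_itv/=; lra.
  apply: ge0_nondecreasing_set_cvg_integral.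
  - move=> m n mn; rewrite subsetEset; apply: subset_itv; rewrite bnd_simp;
      by have := edec _ _ mn; lra.
  - by move=> n; exact: measurable_itv.
  - move=> n; apply/measurable_EFinP.
    by apply: measurable_funTS; exact: continuous_measurable_fun.
  - by move=> n x _; rewrite lee_fin g0// cos_geN1 cos_le1.
(* Endpoints are null, so both sides become integrals over open intervals, limits of the same
   sequence by [AB]. *)
rewrite [LHS]integral_itv_bndoo; last first.
  apply/measurable_EFinP; apply: measurable_div_arcsine => //.
  exact: subset_itv_oo_cc.
rewrite [RHS]integral_itv_bndoo; last first.
  apply/measurable_EFinP.
  by apply: measurable_funTS; exact: continuous_measurable_fun.
rewrite (funext AB) in cvgA.
exact: (cvg_unique _ cvgA cvgB).
Qed.

(** One choice of coefficients, shared by the integral and the quadrature sum. Index 0 gives the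
    mean of the i-th power of cos over [0, pi]. *)
Definition cosXn_coef {R : realType} (i : nat) : nat -> R :=
  sval (cid (cosXn_fourier i)).

Lemma cosXn_coefE {R : realType} (i : nat) (x : R) :
  cos x ^+ i = \sum_(k < i.+1) cosXn_coef i k * cos (k%:R * x).
Proof. exact: (svalP (cid (cosXn_fourier i))). Qed.

Lemma continuous_cosXn {R : realType} (i : nat) : continuous (fun x : R => cos x ^+ i).
Proof.
move=> x; apply: (@continuous_comp _ _ _ cos (fun y : R => y ^+ i)).
  exact: continuous_cos.
exact: exprn_continuous.
Qed.

(** In the termwise antiderivative, every sine vanishes at 0 and at pi, so only the linear primitive
    of the constant term contributes. *)
Lemma integral_cosXn {R : realType} (i : nat) :
  (\int[lebesgue_measure]_(x in `[0%R, pi]) ((cos x : R) ^+ i)%:E =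
   (pi * cosXn_coef i 0)%:E)%E.
Proof.
pose t : nat -> R := cosXn_coef i.
pose G k (x : R) := if k == 0%N then t 0%N * x else t k / k%:R * sin (k%:R * x).
have dG k (x : R) : is_derive x 1 (G k) (t k * cos (k%:R * x)).
  rewrite /G; case: eqP => [->|/eqP k0].
    rewrite mul0r cos0; apply: is_derive_eq.
    by rewrite [_%:A]mulr1 mulr1.
  apply: is_derive_eq; rewrite [k%:R%:A]mulr1 /GRing.scale/=.
  by field; rewrite pnatr_eq0.
pose F : R -> R := \sum_(k < i.+1) G k.
have dF (x : R) : is_derive x 1 F (cos x ^+ i).
  by rewrite cosXn_coefE; apply: is_derive_sum => k; exact: dG.
have cF : continuous F.
  move=> x; apply: differentiable_continuous; apply/derivable1_diffP.
  by case: (dF x).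
rewrite (@continuous_FTC2 _ _ F).
- rewrite /F !fct_sumE [in X in (_ - X)%E]big1; last first.
    by move=> k _; rewrite /G; case: eqP => _; rewrite !mulr0 ?sin0 ?mulr0.
  rewrite sube0 big_ord_recl big1 ?addr0; last first.
    by move=> k _; rewrite /G /= sin_natmul_pi mulr0.
  by rewrite /G/= mulrC.
- exact: pi_gt0.
- by apply: continuous_subspaceT; exact: continuous_cosXn.
- split.
  + by move=> x _; case: (dF x).
  + by apply: cvg_at_right_filter; exact: cF.
  + by apply: cvg_at_left_filter; exact: cF.
- by move=> x _; rewrite derive1E; case: (dF x).
Qed.

(** The moment of order 0 is finite by the substitution, and it dominates the others since |x^i| <=
    1. *)
Lemma integrable_arcsine_moment {R : realType} (i : nat) :
  (@lebesgue_measure R).-integrable `[-1, 1]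
    (fun x : R => (x ^+ i / Num.sqrt (1 - x ^+ 2))%:E).
Proof.
have mX k : measurable_fun (`[-1, 1]%classic : set R)
    (fun x : R => (x ^+ k / Num.sqrt (1 - x ^+ 2))%:E).
  apply/measurable_EFinP; apply: measurable_div_arcsine => //.
  exact: exprn_continuous.
have i0 : (@lebesgue_measure R).-integrable `[-1, 1]
    (fun x : R => (x ^+ 0 / Num.sqrt (1 - x ^+ 2))%:E).
  apply/integrableP; split; first exact: mX.
  under eq_integral.
    move=> x _; rewrite gee0_abs; last by rewrite lee_fin expr0 divr_ge0 ?sqrtr_ge0.
    over.
  rewrite (@ge0_integral_arcsine _ (fun x : R => x ^+ 0)).
  - by rewrite integral_cosXn ltry.
  - exact: exprn_continuous.
  - by move=> x _; rewrite expr0.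
apply: le_integrable i0; [exact: measurable_itv|exact: mX|].
move=> x /=; rewrite in_itv/= => x1; rewrite lee_fin !normrM ler_wpM2r//.
by rewrite expr0 normr1 normrX exprn_ile1// ler_norml.
Qed.

(** For odd [i] the integrand changes sign, so the substitution is applied to 1 + x^i, which is
    nonnegative, and the moment of order 0 is then cancelled. *)
Lemma integral_arcsine_moment {R : realType} (i : nat) :
  (\int[lebesgue_measure]_(x in `[(-1)%R, 1%R])
     ((x : R) ^+ i / Num.sqrt (1 - x ^+ 2))%:E = (pi * cosXn_coef i 0)%:E)%E.
Proof.
have shift : (\int[lebesgue_measure]_(x in `[(-1)%R, 1%R])
     (((x : R) ^+ 0 + x ^+ i) / Num.sqrt (1 - x ^+ 2))%:E =
   \int[lebesgue_measure]_(x in `[0%R, pi]) (cos x ^+ 0 + cos x ^+ i)%:E)%E.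
  apply: (@ge0_integral_arcsine _ (fun x : R => x ^+ 0 + x ^+ i)).
    by move=> x; apply: cvgD; exact: exprn_continuous.
  move=> x x1; rewrite expr0 -lerBlDl sub0r.
  have : `|x ^+ i| <= 1 by rewrite normrX exprn_ile1// ler_norml.
  by rewrite ler_norml => /andP[].
have icos k : (@lebesgue_measure R).-integrable `[0, pi] (fun x : R => (cos x ^+ k)%:E).
  apply: continuous_compact_integrable; first exact: segment_compact.
  by apply: continuous_subspaceT; exact: continuous_cosXn.
move: shift.
under eq_integral do rewrite mulrDl EFinD.
rewrite integralD//; try exact: integrable_arcsine_moment.
under [X in _ = X]eq_integral do rewrite EFinD.
rewrite integralD//.
rewrite (@ge0_integral_arcsine _ (fun x : R => x ^+ 0)); first last.
- by move=> x _; rewrite expr0.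
- exact: exprn_continuous.
rewrite !integral_cosXn.
(* The moment is finite, which brings the cancellation down to real numbers. *)
set I := integral _ _ _.
have /fineK <- : I \is a fin_num.
  by apply: integrable_fin_num => //; exact: integrable_arcsine_moment.
by rewrite -!EFinD => -[/addrI ->].
Qed.

(** * Product measures *)

(** By Tonelli, the iterated integral of the absolute value is the product of two finite
    integrals. *)
Lemma integrable_prod_mul {d1 d2 : measure_display} {T1 : measurableType d1}
    {T2 : measurableType d2} {R : realType}
    (m1 : {sigma_finite_measure set T1 -> \bar R})
    (m2 : {sigma_finite_measure set T2 -> \bar R}) (f : T1 -> R) (g : T2 -> R) :
  m1.-integrable setT (EFin \o f) -> m2.-integrable setT (EFin \o g) ->
  (m1 \x m2)%E.-integrable setT (fun z => (f z.1 * g z.2)%:E).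
Proof.
move=> fi gi.
have mf : measurable_fun setT f by apply/measurable_EFinP; case/integrableP: fi.
have mg : measurable_fun setT g by apply/measurable_EFinP; case/integrableP: gi.
apply/integrable12ltyP.
  apply/measurable_EFinP; apply: measurable_funM.
    by apply: measurableT_comp => //; exact: measurable_fst.
  by apply: measurableT_comp => //; exact: measurable_snd.
have /integrableP[_ afi] := fi; have /integrableP[_ agi] := gi.
under eq_integral => x _.
  under eq_integral do rewrite /= normrM EFinM.
  rewrite ge0_integralZl//; last first.
    by apply/measurable_EFinP; exact: measurableT_comp.
  rewrite muleC.
  over.
rewrite ge0_integralZl//.
- by apply: lte_mul_pinfty => //; [exact: integral_ge0|
    rewrite ge0_fin_numE//; exact: integral_ge0].
- by apply/measurable_EFinP; exact: measurableT_comp.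
- exact: integral_ge0.
Qed.

Lemma integral_prod_mul {d1 d2 : measure_display} {T1 : measurableType d1}
    {T2 : measurableType d2} {R : realType}
    (m1 : {sigma_finite_measure set T1 -> \bar R})
    (m2 : {sigma_finite_measure set T2 -> \bar R}) (f : T1 -> R) (g : T2 -> R)
    (a b : R) :
  m1.-integrable setT (EFin \o f) -> m2.-integrable setT (EFin \o g) ->
  (\int[m1]_x (f x)%:E = a%:E)%E -> (\int[m2]_x (g x)%:E = b%:E)%E ->
  (\int[m1 \x m2]_z (f z.1 * g z.2)%:E = (a * b)%:E)%E.
Proof.
move=> fi gi fa gb.
rewrite -integral12_prod_meas1; last exact: integrable_prod_mul.
rewrite /fubini_F/=.
under eq_integral => x _.
  under eq_integral do rewrite EFinM.
  rewrite integralZl// gb muleC.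
  over.
by rewrite integralZl// fa -EFinM mulrC.
Qed.

Lemma sigma_finite_product_measure1 {d1 d2 : measure_display}
    {T1 : measurableType d1} {T2 : measurableType d2} {R : realType}
    (m1 : {sigma_finite_measure set T1 -> \bar R})
    (m2 : {sigma_finite_measure set T2 -> \bar R}) :
  sigma_finite setT (m1 \x m2)%E.
Proof.
have [F TF Foo] := sigma_finiteT m1; have [G TG Goo] := sigma_finiteT m2.
(* Rectangles are enumerated through a coding of pairs; a number that codes no pair merely repeats
   the first rectangle. *)
exists (fun n => let ij := odflt (0%N, 0%N) (unpickle n) in F ij.1 `*` G ij.2).
  apply/esym/seteqP; split=> // -[x y] _.
  have [i _ Fx] : (\bigcup_i F i) x by rewrite -TF.
  have [j _ Gy] : (\bigcup_j G j) y by rewrite -TG.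
  by exists (pickle (i, j)) => //; rewrite pickleK.
move=> n /=; case: (odflt _ _) => i j /=.
have [mF Fi] := Foo i; have [mG Gj] := Goo j; split; first exact: measurableX.
by rewrite product_measure1E// lte_mul_pinfty// ge0_fin_numE.
Qed.

(* The canonical sigma-finite structure that the library attaches to
   [product_measure1] is the one for products of subprobabilities, so the
   product needs a name of its own to carry the general one. *)
Definition sigma_finite_product {d1 d2 : measure_display}
    {T1 : measurableType d1} {T2 : measurableType d2} {R : realType}
    (m1 : {sigma_finite_measure set T1 -> \bar R})
    (m2 : {sigma_finite_measure set T2 -> \bar R}) :
  set (T1 * T2)%type -> \bar R := (m1 \x m2)%E.

HB.instance Definition _ {d1 d2 : measure_display}
    {T1 : measurableType d1} {T2 : measurableType d2} {R : realType}
    (m1 : {sigma_finite_measure set T1 -> \bar R})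
    (m2 : {sigma_finite_measure set T2 -> \bar R}) :=
  measure_function.Measure.copy (sigma_finite_product m1 m2) (m1 \x m2)%E.

HB.instance Definition _ {d1 d2 : measure_display}
    {T1 : measurableType d1} {T2 : measurableType d2} {R : realType}
    (m1 : {sigma_finite_measure set T1 -> \bar R})
    (m2 : {sigma_finite_measure set T2 -> \bar R}) :=
  @Measure_isSigmaFinite.Build _ _ _ (sigma_finite_product m1 m2)
    (sigma_finite_product_measure1 m1 m2).

Lemma integrable_prod_mul3 {d1 d2 d3 : measure_display} {T1 : measurableType d1}
    {T2 : measurableType d2} {T3 : measurableType d3} {R : realType}
    (m1 : {sigma_finite_measure set T1 -> \bar R})
    (m2 : {sigma_finite_measure set T2 -> \bar R})
    (m3 : {sigma_finite_measure set T3 -> \bar R})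
    (f : T1 -> R) (g : T2 -> R) (h : T3 -> R) :
  m1.-integrable setT (EFin \o f) -> m2.-integrable setT (EFin \o g) ->
  m3.-integrable setT (EFin \o h) ->
  ((m1 \x m2) \x m3)%E.-integrable setT
    (fun z => (f z.1.1 * g z.1.2 * h z.2)%:E).
Proof.
move=> fi gi hi.
exact: (integrable_prod_mul (sigma_finite_product m1 m2) m3 (fun z => f z.1 * g z.2) h
  (integrable_prod_mul m1 m2 f g fi gi) hi).
Qed.

Lemma integral_prod_mul3 {d1 d2 d3 : measure_display} {T1 : measurableType d1}
    {T2 : measurableType d2} {T3 : measurableType d3} {R : realType}
    (m1 : {sigma_finite_measure set T1 -> \bar R})
    (m2 : {sigma_finite_measure set T2 -> \bar R})
    (m3 : {sigma_finite_measure set T3 -> \bar R})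
    (f : T1 -> R) (g : T2 -> R) (h : T3 -> R) (a b c : R) :
  m1.-integrable setT (EFin \o f) -> m2.-integrable setT (EFin \o g) ->
  m3.-integrable setT (EFin \o h) ->
  (\int[m1]_x (f x)%:E = a%:E)%E -> (\int[m2]_x (g x)%:E = b%:E)%E ->
  (\int[m3]_x (h x)%:E = c%:E)%E ->
  (\int[(m1 \x m2) \x m3]_z (f z.1.1 * g z.1.2 * h z.2)%:E = (a * b * c)%:E)%E.
Proof.
move=> fi gi hi fa gb hc.
exact: (integral_prod_mul (sigma_finite_product m1 m2) m3 (fun z => f z.1 * g z.2) h _ _
  (integrable_prod_mul m1 m2 f g fi gi) hi
  (integral_prod_mul m1 m2 f g _ _ fi gi fa gb) hc).
Qed.

(** Extension by zero to the whole line turns integrals over the cube into integrals of separated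
    products over the whole space. *)
Definition arcsine_monomial {R : realType} (i : nat) (x : measurableTypeR R) : R :=
  ((fun y : R => y ^+ i / Num.sqrt (1 - y ^+ 2)) \_ `[-1, 1]) x.

Lemma integrable_arcsine_monomial {R : realType} (i : nat) :
  (@lebesgue_measure R).-integrable setT (EFin \o arcsine_monomial i).
Proof.
rewrite /arcsine_monomial -restrict_EFin.
by apply: (integrable_mkcond _ _).1 => //; exact: integrable_arcsine_moment.
Qed.

Lemma integral_arcsine_monomial {R : realType} (i : nat) :
  (\int[@lebesgue_measure R]_x (arcsine_monomial i x)%:E = (pi * cosXn_coef i 0)%:E)%E.
Proof.
rewrite -integral_arcsine_moment [RHS]integral_mkcond.
by apply: eq_integral => x _; rewrite /arcsine_monomial !patchE; case: ifP.
Qed.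

Lemma integrable_monomial3 {R : realType} (i j k : nat) :
  (lebesgue3 R).-integrable setT (fun z =>
    (arcsine_monomial i z.1.1 * arcsine_monomial j z.1.2 * arcsine_monomial k z.2)%:E).
Proof.
exact: (@integrable_prod_mul3 _ _ _ _ _ _ _ (@lebesgue_measure R)
  (@lebesgue_measure R) (@lebesgue_measure R) _ _ _
  (integrable_arcsine_monomial i) (integrable_arcsine_monomial j)
  (integrable_arcsine_monomial k)).
Qed.

Lemma integral_monomial3 {R : realType} (i j k : nat) :
  (\int[lebesgue3 R]_z
    (arcsine_monomial i z.1.1 * arcsine_monomial j z.1.2 * arcsine_monomial k z.2)%:E
   = ((pi * cosXn_coef i 0) * (pi * cosXn_coef j 0) * (pi * cosXn_coef k 0))%:E)%E.
Proof.
exact: (@integral_prod_mul3 _ _ _ _ _ _ _ (@lebesgue_measure R)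
  (@lebesgue_measure R) (@lebesgue_measure R) _ _ _ _ _ _
  (integrable_arcsine_monomial i) (integrable_arcsine_monomial j)
  (integrable_arcsine_monomial k)
  (integral_arcsine_monomial i) (integral_arcsine_monomial j)
  (integral_arcsine_monomial k)).
Qed.

(** * The quadrature formula *)

Lemma eval3E {R : realType} (p : mpoly 3 R) (x : R * R * R) :
  eval3 p x = \sum_(m <- msupp p) mcoeff m p *
    (x.1.1 ^+ m ord0 * x.1.2 ^+ m (lift ord0 ord0)
     * x.2 ^+ m (lift ord0 (lift ord0 ord0))).
Proof.
rewrite /eval3 mevalE; apply: eq_bigr => m _.
by rewrite !big_ord_recl big_ord0 mulr1 !(tnth_nth 0) /= !mulrA.
Qed.

Lemma mdeg3E (m : multinom 3) :
  mdeg m = (m ord0 + m (lift ord0 ord0) + m (lift ord0 (lift ord0 ord0)))%N.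
Proof. by rewrite mdegE !big_ord_recl big_ord0 addn0 addnA. Qed.

(** The indicator of the cube is a product of indicators, and the square root splits because each
    factor under it is nonnegative there. On the faces both sides are 0, by the convention for
    0^-1. *)
Lemma arcsine_monomial3E {R : realType} (i j k : nat) (z : R * R * R) :
  arcsine_monomial i z.1.1 * arcsine_monomial j z.1.2 * arcsine_monomial k z.2 =
  if z \in cube R then z.1.1 ^+ i * z.1.2 ^+ j * z.2 ^+ k * cheb_weight z else 0.
Proof.
case: z => -[x y] z /=; rewrite /arcsine_monomial !patchE.
have -> : point = 0 :> R by [].
have [|zc] := boolP ((x, y, z) \in cube R).
  rewrite inE => -[[/= x1 y1] z1]; rewrite !mem_set// /cheb_weight/=.
  move: x1 y1 z1; rewrite /= !in_itv/= => x1 y1 z1.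
  have one_sub_ge0 (a : R) : -1 <= a <= 1 -> 0 <= 1 - a ^+ 2 by nra.
  by rewrite !sqrtrM ?mulr_ge0 ?one_sub_ge0// !invfM; ring.
case: ifPn => [|_]; last by rewrite !mul0r.
case: ifPn => [|_]; last by rewrite mulr0 mul0r.
case: ifPn => [|_]; last by rewrite mulr0.
by rewrite !inE => z1 y1 x1; case/negP: zc; rewrite inE.
Qed.

Lemma integral_cheb_weight {R : realType} (p : mpoly 3 R) :
  (\int[lebesgue3 R]_(x in cube R) (eval3 p x * cheb_weight x)%:E =
   (\sum_(m <- msupp p) mcoeff m p * ((pi * cosXn_coef (m ord0) 0)
      * (pi * cosXn_coef (m (lift ord0 ord0)) 0)
      * (pi * cosXn_coef (m (lift ord0 (lift ord0 ord0))) 0)))%:E)%E.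
Proof.
rewrite integral_mkcond.
transitivity (\int[lebesgue3 R]_x \sum_(m <- msupp p) (mcoeff m p)%:E *
  (arcsine_monomial (m ord0) x.1.1 * arcsine_monomial (m (lift ord0 ord0)) x.1.2
   * arcsine_monomial (m (lift ord0 (lift ord0 ord0))) x.2)%:E)%E.
  apply: eq_integral => x _; rewrite patchE.
  under eq_bigr do rewrite arcsine_monomial3E.
  case: ifP => _; last by rewrite big1// => m _; rewrite mule0.
  rewrite eval3E mulr_suml -sumEFin; apply: eq_bigr => m _.
  by rewrite -EFinM -[in LHS](mulrA (mcoeff m p)).
rewrite integral_sum//; last first.
  by move=> m; apply: integrableZl => //; exact: integrable_monomial3.
rewrite -sumEFin; apply: eq_bigr => m _.
by rewrite integralZl// ?integral_monomial3//; exact: integrable_monomial3.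
Qed.

(** Expanding the three powers into cosines gives a triple sum in which, by [freq_cos_quadrature],
    only the term of index (0, 0, 0) survives. *)
Lemma curve_monomial_quadrature {R : realType} (n N : nat) (omega theta : nat -> R)
    (i j k : nat) : (1 <= n)%N -> is_cos_quadrature (2 * nu n) N omega theta ->
  (i + j + k <= 2 * n)%N ->
  \sum_(0 <= s < N) omega s * (cos ((freq_a n)%:R * theta s) ^+ i *
    cos ((freq_b n)%:R * theta s) ^+ j * cos ((freq_c n)%:R * theta s) ^+ k) =
  pi * (cosXn_coef i 0 * cosXn_coef j 0 * cosXn_coef k 0).
Proof.
move=> n1 quad ijk.
transitivity (\sum_(i' < i.+1) \sum_(j' < j.+1) \sum_(k' < k.+1)
    cosXn_coef i i' * cosXn_coef j j' * cosXn_coef k k' *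
    \sum_(0 <= s < N) omega s * (cos (i'%:R * ((freq_a n)%:R * theta s)) *
      cos (j'%:R * ((freq_b n)%:R * theta s)) *
      cos (k'%:R * ((freq_c n)%:R * theta s)))).
  under [RHS]eq_bigr do under eq_bigr do under eq_bigr do rewrite mulr_sumr.
  under [RHS]eq_bigr do under eq_bigr do rewrite exchange_big.
  under [RHS]eq_bigr do rewrite exchange_big.
  rewrite [RHS]exchange_big; apply: eq_bigr => s _ /=.
  rewrite !cosXn_coefE -mulrA mulr_suml mulr_sumr; apply: eq_bigr => i' _.
  rewrite mulr_suml !mulr_sumr; apply: eq_bigr => j' _.
  rewrite !mulr_sumr; apply: eq_bigr => k' _.
  by ring.
have deg (i' : 'I_i.+1) (j' : 'I_j.+1) (k' : 'I_k.+1) : (i' + j' + k' <= 2 * n)%N.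
  by have := ltn_ord i'; have := ltn_ord j'; have := ltn_ord k'; lia.
under eq_bigr => i' _ do under eq_bigr => j' _ do under eq_bigr => k' _ do
  rewrite (freq_cos_quadrature n N omega theta i' j' k' n1 quad (deg i' j' k')).
(* Each of the three sums is reduced in turn to its index 0. *)
rewrite big_ord_recl [X in _ + X]big1 ?addr0; last first.
  by move=> i' _; rewrite big1// => j' _; rewrite big1// => k' _; rewrite mulr0.
rewrite big_ord_recl [X in _ + X]big1 ?addr0; last first.
  by move=> j' _; rewrite big1// => k' _; rewrite mulr0.
rewrite big_ord_recl [X in _ + X]big1 ?addr0; last first.
  by move=> k' _; rewrite mulr0.
by rewrite mulrC.
Qed.

(** Both sides are compared monomial by monomial. The cube contributes one factor pi per variable
    and the curve a single one, which accounts for the pi^2 in the weights. *)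
Lemma cheb_weight_quadrature {R : realType} (n N : nat) (omega theta : nat -> R)
    (p : mpoly 3 R) : (1 <= n)%N -> poly3_le (2 * n) p ->
  is_cos_quadrature (2 * nu n) N omega theta ->
  (\int[lebesgue3 R]_(x in cube R) (eval3 p x * cheb_weight x)%:E =
   (\sum_(0 <= s < N) pi ^+ 2 * omega s * eval3 p (curve n (theta s)))%:E)%E.
Proof.
move=> n1 hp quad; rewrite integral_cheb_weight; congr EFin.
under [RHS]eq_bigr do rewrite eval3E mulr_sumr.
(* Membership of [m] in the support is kept, as it yields the degree bound. *)
rewrite exchange_big/= big_seq [RHS]big_seq; apply: eq_bigr => m mp.
have := curve_monomial_quadrature n N omega theta (m ord0) (m (lift ord0 ord0))
  (m (lift ord0 (lift ord0 ord0))) n1 quad.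
rewrite -mdeg3E -ltnS => /(_ (leq_trans (msize_mdeg_lt mp) hp)) quadm.
transitivity (mcoeff m p * pi ^+ 2 * (pi * (cosXn_coef (m ord0) 0
    * cosXn_coef (m (lift ord0 ord0)) 0
    * cosXn_coef (m (lift ord0 (lift ord0 ord0))) 0))).
  by ring.
rewrite -quadm mulr_sumr; apply: eq_bigr => s _.
by rewrite /curve/=; ring.
Qed.

Theorem corollary1 (R : realType) (n : nat) (p : mpoly 3 R)
    (hn : (1 <= n)%N) (hp : poly3_le (2 * n) p) :
  (nu n)%:R = (if odd n
               then 3 / 4 * n%:R ^+ 3 + 3 / 2 * n%:R ^+ 2 + 3 / 4 * n%:R
               else 3 / 4 * n%:R ^+ 3 + 3 / 2 * n%:R ^+ 2 + n%:R) :> R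
  /\
  (let mu := nu n in
   let theta (s : nat) : R := (2 * s + 1)%:R * pi / (2 * mu + 2)%:R in
   let omega (s : nat) : R := pi / (mu + 1)%:R in
   (\int[lebesgue3 R]_(x in cube R) (eval3 p x * cheb_weight x)%:E)%E
   = (\sum_(0 <= s < mu.+1)
        pi ^+ 2 * omega s * eval3 p (curve n (theta s)))%:E)
  /\
  (let mu := (nu n + 1)%N in
   let theta (s : nat) : R := s%:R * pi / mu%:R in
   let omega (s : nat) : R :=
     if (s == 0%N) || (s == mu) then pi / (2 * mu)%:R else pi / mu%:R in
   (\int[lebesgue3 R]_(x in cube R) (eval3 p x * cheb_weight x)%:E)%E
   = (\sum_(0 <= s < mu.+1)
        pi ^+ 2 * omega s * eval3 p (curve n (theta s)))%:E).
Proof.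
split; first by rewrite nuE// natrM freq_cE//; case: odd; field.
split; cbv zeta.
  by apply: (cheb_weight_quadrature n) => //; apply: midpoint_quadrature; lia.
(* The extra subinterval is what gives 2 nu < 2 mu: with mu = nu, the frequency 2 nu would equal 1
   at every node. *)
by apply: (cheb_weight_quadrature n) => //; apply: trapezoid_quadrature; lia.
Qed.
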